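(* Every local ring is right strongly exchange and left strongly exchange.
   Context: Rings are associative with identity, not necessarily commutative. A right coprime pair in $R$ is a pair of elements $a,b\in R$ with $aR+bR=R$. Two right coprime pairs $(a,b)$, $(a',b')$ are identified when $aR=a'R$ and $bR=b'R$; $\langle a,b\rangle$ denotes the equivalence class, $\mathrm{RCP}(R)$ the set of all classes, and a pair $(a',b')$ with $\langle a',b'\rangle=\langle a,b\rangle$ is called a pair of generators of $\langle a,b\rangle$. $\mathrm{RCP}(R)$ is partially ordered by $\langle a,b\rangle\le\langle a',b'\rangle$ iff $aR\subseteq a'R$ and $bR\subseteq b'R$. A compatible descending chain of right coprime pairs is a family $\{p_\alpha\mid\alpha<\kappa\}\subseteq \mathrm{RCP}(R)$ ($\kappa$ an ordinal, $p_\beta\le p_\alpha$ for $\alpha<\beta<\kappa$) such that there exist a pair of generators $(a_\alpha,b_\alpha)$ of $p_\alpha$ for each $\alpha<\kappa$, and elements $r_{\alpha\beta},s_{\alpha\beta}\in R$ for $\alpha<\beta<\kappa$, with $a_\beta=a_\alpha r_{\alpha\beta}$ and $b_\beta=b_\alpha s_{\alpha\beta}$ for all $\alpha<\beta<\kappa$, and $r_{\alpha\beta}=r_{\alpha\gamma}r_{\gamma\beta}$, $s_{\alpha\beta}=s_{\alpha\gamma}s_{\gamma\beta}$ for all $\alpha<\gamma<\beta<\kappa$. A minimal lower bound of a chain is a lower bound of the chain in $\mathrm{RCP}(R)$ that is a minimal element of the poset $\mathrm{RCP}(R)$. The ring $R$ is right strongly exchange if every compatible descending chain of right coprime pairs of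 $R$ has a minimal lower bound; it is left strongly exchange if the opposite ring $R^{\mathrm{op}}$ is right strongly exchange. *)

(* Defs.v *)
From HB Require Import structures.
From mathcomp Require Import all_boot all_order all_algebra.
From mathcomp Require Import boolp classical_sets.

Set Implicit Arguments.
Unset Strict Implicit.
Unset Printing Implicit Defensive.

Import Order.TTheory GRing.Theory.
Local Open Scope classical_set_scope.
Local Open Scope ring_scope.
Local Open Scope quotient_scope.

(* Rings are of type pzRingType: not necessarily commutative, and possibly
   zero. *)

(* The library's idealr_closed and idealr are not used here: they ask for
   closure under multiplication on the left. *)
Definition right_ideal (R : pzRingType) (I : set R) : Prop :=
  [/\ I 0, forall x y, I x -> I y -> I (x - y) & forall x r, I x -> I (x * r)].

Definition maximal_right_ideal (R : pzRingType) (M : set R) : Prop :=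
  [/\ right_ideal M, M <> setT &
      forall I, right_ideal I -> M `<=` I -> I <> setT -> I = M].

(* The zero ring is not local: it has no proper right ideal. *)
Definition local_ring (R : pzRingType) : Prop :=
  exists! M : set R, maximal_right_ideal M.

Definition principal_right_ideal (R : pzRingType) (a : R) : set R :=
  [set a * r | r in setT].

Definition right_coprime (R : pzRingType) (a b : R) : Prop :=
  [set x + y | x in principal_right_ideal a & y in principal_right_ideal b]
    = setT.

Record rcpair (R : pzRingType) := RCPair {
  rcpair_val :> R * R;
  _ : `[< right_coprime rcpair_val.1 rcpair_val.2 >] }.

HB.instance Definition _ (R : pzRingType) := [isSub for @rcpair_val R].
HB.instance Definition _ (R : pzRingType) := [Choice of rcpair R by <:].

Definition rcpair_equiv (R : pzRingType) : rel (rcpair R) := fun x y =>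
  `[< principal_right_ideal x.1 = principal_right_ideal y.1 /\
      principal_right_ideal x.2 = principal_right_ideal y.2 >].

Lemma rcpair_equiv_refl (R : pzRingType) : reflexive (@rcpair_equiv R).
Proof. by move=> x; apply/asboolP. Qed.

Lemma rcpair_equiv_sym (R : pzRingType) : symmetric (@rcpair_equiv R).
Proof. by move=> x y; apply/asboolP/asboolP => -[-> ->]. Qed.

Lemma rcpair_equiv_trans (R : pzRingType) : transitive (@rcpair_equiv R).
Proof.
by move=> y x z /asboolP[xy1 xy2] /asboolP[yz1 yz2]; apply/asboolP; rewrite xy1 xy2.
Qed.

Canonical rcpair_equiv_rel (R : pzRingType) :=
  EquivRel (@rcpair_equiv R) (@rcpair_equiv_refl R) (@rcpair_equiv_sym R)
    (@rcpair_equiv_trans R).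

Definition RCP (R : pzRingType) : Type := {eq_quot @rcpair_equiv R}.

HB.instance Definition _ (R : pzRingType) := Choice.on (RCP R).
HB.instance Definition _ (R : pzRingType) := EqQuotient.on (RCP R).

Definition rcpair_le (R : pzRingType) : rel (rcpair R) := fun x y =>
  `[< principal_right_ideal x.1 `<=` principal_right_ideal y.1 /\
      principal_right_ideal x.2 `<=` principal_right_ideal y.2 >].

(* The choice of representatives is immaterial, see le_rcpE. *)
Definition rcp_le (R : pzRingType) : rel (RCP R) := fun p q =>
  rcpair_le (repr p) (repr q).

Lemma rcp_eqP (R : pzRingType) (x y : rcpair R) :
  \pi_(RCP R) x = \pi_(RCP R) y <->
  principal_right_ideal x.1 = principal_right_ideal y.1 /\
  principal_right_ideal x.2 = principal_right_ideal y.2.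
Proof.
split=> [/eqP|xy]; first by rewrite eqmodE => /asboolP.
by apply/eqP; rewrite eqmodE; apply/asboolP.
Qed.

Lemma rcp_le_refl (R : pzRingType) : reflexive (@rcp_le R).
Proof. by move=> p; apply/asboolP; split. Qed.

Lemma rcp_le_anti (R : pzRingType) : antisymmetric (@rcp_le R).
Proof.
move=> p q /andP[/asboolP[p1 p2] /asboolP[q1 q2]].
rewrite -[p]reprK -[q]reprK; apply/rcp_eqP.
by split; apply/seteqP; split.
Qed.

Lemma rcp_le_trans (R : pzRingType) : transitive (@rcp_le R).
Proof.
move=> q p r /asboolP[p1 p2] /asboolP[q1 q2]; apply/asboolP.
by split; [apply: subset_trans q1 | apply: subset_trans q2].
Qed.

Fact rcp_display : Order.disp_t. Proof. exact: Order.Disp tt tt. Qed.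

HB.instance Definition _ (R : pzRingType) :=
  Order.Le_isPOrder.Build rcp_display (RCP R)
    (@rcp_le_refl R) (@rcp_le_anti R) (@rcp_le_trans R).

Lemma le_rcpE (R : pzRingType) (x y : rcpair R) :
  (\pi_(RCP R) x <= \pi_(RCP R) y)%O = rcpair_le x y.
Proof.
rewrite /Order.le /= /rcp_le /rcpair_le.
have /rcp_eqP[-> ->] := reprK (\pi_(RCP R) x).
by have /rcp_eqP[-> ->] := reprK (\pi_(RCP R) y).
Qed.

(* Families indexed by an ordinal are rendered as families indexed by a
   well-ordered type I; the values of r and s at (i, j) matter only for
   i < j. *)
Definition compatible_descending_chain (R : pzRingType) (d : Order.disp_t)
    (I : orderType d) (p : I -> RCP R) : Prop :=
  (forall i j : I, (i < j)%O -> (p j <= p i)%O) /\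
  exists (g : I -> rcpair R) (r s : I -> I -> R),
    [/\ forall i, \pi_(RCP R) (g i) = p i,
        forall i j : I, (i < j)%O ->
          (g j).1 = (g i).1 * r i j /\ (g j).2 = (g i).2 * s i j &
        forall i k j : I, (i < k)%O -> (k < j)%O ->
          r i j = r i k * r k j /\ s i j = s i k * s k j].

Definition minimal_lower_bound (R : pzRingType) (I : Type) (p : I -> RCP R)
    (q : RCP R) : Prop :=
  (forall i, (q <= p i)%O) /\ (forall q' : RCP R, (q' <= q)%O -> q' = q).

Definition right_strongly_exchange (R : pzRingType) : Prop :=
  forall (d : Order.disp_t) (I : orderType d),
    well_founded (fun i j : I => (i < j)%O) ->
    forall p : I -> RCP R, compatible_descending_chain p ->
    exists q : RCP R, minimal_lower_bound p q.

(* R^c is the opposite ring of R. *)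
Definition left_strongly_exchange (R : pzRingType) : Prop :=
  right_strongly_exchange R^c.

(* Main.v *)
(* In a local ring, for every x either x or 1 - x is two-sided invertible. This
   condition is left-right symmetric, and it forces one entry of a coprime pair
   to generate R. In a chain the same entry does so for all members, so that
   <1, 0> or <0, 1>, which are minimal in RCP(R), is a lower bound. *)
Require Import Defs.
From mathcomp Require Import all_boot all_order all_algebra.
From mathcomp Require Import boolp classical_sets.

Set Implicit Arguments.
Unset Strict Implicit.
Unset Printing Implicit Defensive.

Import Order.TTheory GRing.Theory.
Local Open Scope classical_set_scope.
Local Open Scope ring_scope.
Local Open Scope quotient_scope.

Section RightIdeals.
Variable R : pzRingType.
Implicit Types (a b x y : R) (I : set R).

Lemma right_ideal_oppr I x : right_ideal I -> I x -> I (- x).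
Proof. by case=> I0 IB _ Ix; rewrite -sub0r; apply: IB. Qed.

Lemma right_ideal_addr I x y : right_ideal I -> I x -> I y -> I (x + y).
Proof.
move=> Iid Ix Iy; rewrite -[y]opprK; have [_ IB _] := Iid.
by apply: IB => //; apply: right_ideal_oppr.
Qed.

Lemma right_ideal_eqT I : right_ideal I -> (I = setT) <-> I 1.
Proof.
case=> _ _ IM; split=> [->//|I1].
by apply/seteqP; split=> // x _; rewrite -[x]mul1r; apply: IM.
Qed.

Lemma principal_right_idealP a : right_ideal (principal_right_ideal a).
Proof.
split=> [|_ _ [r _ <-] [s _ <-]|_ s [r _ <-]].
- by exists 0; rewrite ?mulr0.
- by exists (r - s); rewrite ?mulrBr.
- by exists (r * s); rewrite ?mulrA.
Qed.

Lemma principal_right_ideal_eqT a :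
  principal_right_ideal a = setT <-> exists b, a * b = 1.
Proof.
split=> [aT|[b ab]]; last first.
  by apply/seteqP; split=> // x _; exists (b * x); rewrite ?mulrA ?ab ?mul1r.
have : principal_right_ideal a 1 by rewrite aT.
by case=> b _ ab; exists b.
Qed.

Lemma principal_right_ideal1 : principal_right_ideal (1 : R) = setT.
Proof. by apply/principal_right_ideal_eqT; exists 1; rewrite mulr1. Qed.

Lemma principal_right_ideal0 : principal_right_ideal (0 : R) = [set 0].
Proof.
apply/seteqP; split=> [_ [r _ <-]|_ ->]; first by rewrite /= mul0r.
by exists 0; rewrite ?mulr0.
Qed.

Lemma right_coprimeP a b :
  right_coprime a b <-> exists r s, a * r + b * s = 1.
Proof.
split=> [ab|[r [s rs]]].
  have : [set x + y | x in principal_right_ideal a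
                    & y in principal_right_ideal b] 1 by rewrite ab.
  by case=> _ [r _ <-] [_ [s _ <-] rs]; exists r, s.
apply/seteqP; split=> // x _.
exists (a * (r * x)); first by exists (r * x).
exists (b * (s * x)); first by exists (s * x).
by rewrite !mulrA -mulrDl rs mul1r.
Qed.

(** Krull's theorem for right ideals: being proper means omitting [1], a condition that survives
    unions of chains, so Zorn's lemma applies. *)
Lemma right_ideal_sub_maximal I : right_ideal I -> ~ I 1 ->
  exists M, maximal_right_ideal M /\ I `<=` M.
Proof.
move=> Iid I1; have [I0 IB IM] := Iid.
(* Adjoining I to every member of the family lets the empty chain, whose union
   is empty, satisfy the chain condition of Zorn's lemma. *)
pose P := [set X : set R | right_ideal (X `|` I) /\ ~ (X `|` I) 1].
have [F FP Ftot|A [[Aid A1] Amax]] := @Zorn_bigcup R P.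
  split; last first.
    by case=> [[X FX X1]|//]; have [_] := FP _ FX; apply; left.
  have lift X x : F X -> (X `|` I) x -> (\bigcup_(Y in F) Y `|` I) x.
    by move=> FX [Xx|]; [left; exists X|right].
  split=> [|x y|x r]; first by right.
  - move=> [[X FX Xx]|Ix] [[Y FY Yy]|Iy]; last by right; apply: IB.
    + have [XY|YX] := Ftot _ _ FX FY.
        by have [[_ YB _] _] := FP _ FY; apply: (lift Y) => //; apply: YB;
          left => //; apply: XY.
      by have [[_ XB _] _] := FP _ FX; apply: (lift X) => //; apply: XB;
        left => //; apply: YX.
    + have [[_ XB _] _] := FP _ FX.
      by apply: (lift X) => //; apply: XB; [left|right].
    + have [[_ YB _] _] := FP _ FY.
      by apply: (lift Y) => //; apply: YB; [right|left].
  - move=> [[X FX Xx]|Ix]; last by right; apply: IM.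
    by have [[_ _ XM] _] := FP _ FX; apply: (lift X) => //; apply: XM; left.
exists (A `|` I); split; last by move=> x Ix; right.
split=> //; first by move/(right_ideal_eqT Aid).
move=> J Jid AJ JT; apply/seteqP; split=> // x Jx.
have JI : J `|` I = J.
  by apply/seteqP; split=> [y [//|Iy]|y Jy]; [apply: AJ; right|left].
(* Zorn gives maximality of [A], not of its union with [I]. A point [x] of [J] outside that union
   makes [A] a proper subset of [J], and [J] is in [P] because it contains [I]. *)
apply: contrapT => Ax; apply: (Amax J).
  split=> [y Ay|JA]; first by apply: AJ; left.
  by apply: Ax; left; apply: JA.
by split; rewrite JI // => /(right_ideal_eqT Jid).
Qed.

(** Serves the minimality of <1, 0>: below it the second entry vanishes, and [a * r + b * s = 1]
    collapses to [a * r = 1]. *)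
Lemma right_coprime_eqTl a b : right_coprime a b ->
  principal_right_ideal b `<=` principal_right_ideal 0 ->
  principal_right_ideal a = setT.
Proof.
rewrite principal_right_ideal0 => /right_coprimeP[r [s rs]] b0.
apply/principal_right_ideal_eqT; exists r.
by rewrite -[a * r]addr0 -(b0 (b * s)) //; exists s.
Qed.

Lemma right_coprime_eqTr a b : right_coprime a b ->
  principal_right_ideal a `<=` principal_right_ideal 0 ->
  principal_right_ideal b = setT.
Proof.
rewrite principal_right_ideal0 => /right_coprimeP[r [s rs]] a0.
apply/principal_right_ideal_eqT; exists s.
by rewrite -[b * s]add0r -(a0 (a * r)) //; exists r.
Qed.

Lemma sub_principal_right_ideal0 a :
  principal_right_ideal 0 `<=` principal_right_ideal a.
Proof.
by rewrite principal_right_ideal0 => _ ->; case: (principal_right_idealP a).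
Qed.

Lemma rcpairP (x : rcpair R) : right_coprime x.1 x.2.
Proof. by case: x => ? /= /asboolP. Qed.

Lemma minimal_lower_bound10 (J : Type) (p : J -> RCP R) :
  (forall i, principal_right_ideal (repr (p i)).1 = setT) ->
  exists q, minimal_lower_bound p q.
Proof.
move=> pT.
have c10 : `[< right_coprime (1 : R, 0 : R).1 (1 : R, 0 : R).2 >].
  by apply/asboolP/right_coprimeP; exists 1, 0; rewrite mulr1 mul0r addr0.
exists (\pi_(RCP R) (RCPair c10)); split=> [i|q].
  rewrite -[p i]reprK le_rcpE; apply/asboolP; rewrite pT; split=> //.
  exact: sub_principal_right_ideal0.
rewrite -[q]reprK le_rcpE => /asboolP[_ /= q0]; apply/rcp_eqP; split=> /=.
  by rewrite principal_right_ideal1 (right_coprime_eqTl (rcpairP _) q0).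
by apply/seteqP; split=> //; apply: sub_principal_right_ideal0.
Qed.

Lemma minimal_lower_bound01 (J : Type) (p : J -> RCP R) :
  (forall i, principal_right_ideal (repr (p i)).2 = setT) ->
  exists q, minimal_lower_bound p q.
Proof.
move=> pT.
have c01 : `[< right_coprime (0 : R, 1 : R).1 (0 : R, 1 : R).2 >].
  by apply/asboolP/right_coprimeP; exists 0, 1; rewrite mulr1 mul0r add0r.
exists (\pi_(RCP R) (RCPair c01)); split=> [i|q].
  rewrite -[p i]reprK le_rcpE; apply/asboolP; rewrite pT; split=> //.
  exact: sub_principal_right_ideal0.
rewrite -[q]reprK le_rcpE => /asboolP[/= q0 _]; apply/rcp_eqP; split=> /=.
  by apply/seteqP; split=> //; apply: sub_principal_right_ideal0.
by rewrite principal_right_ideal1 (right_coprime_eqTr (rcpairP _) q0).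
Qed.

End RightIdeals.

(** Two-sided, so that the notion is the same in [R] and in [R^c]. *)
Definition invertible (R : pzRingType) (x : R) : Prop :=
  exists y, x * y = 1 /\ y * x = 1.

(** Every element outside the maximal right ideal [M] is invertible, and [M] cannot contain both [x]
    and [1 - x], whose sum is [1]. *)
Lemma local_ring_invertible (R : pzRingType) : local_ring R ->
  forall x : R, invertible x \/ invertible (1 - x).
Proof.
case=> M [[Mid MT Mmax] Muniq].
have M1 : ~ M 1 by move/(right_ideal_eqT Mid).
have [_ _ MM] := Mid.
have rinv (x : R) : ~ M x -> exists y, x * y = 1.
  (* If [x] generated a proper right ideal, some maximal one would contain it; by uniqueness that is
     [M]. *)
  move=> Mx; apply/principal_right_ideal_eqT; apply: contrapT => xT.
  have xid := principal_right_idealP x.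
  have [|N [Nmax xN]] := right_ideal_sub_maximal xid.
    by move/(right_ideal_eqT xid).
  by apply: Mx; rewrite (Muniq _ Nmax); apply: xN; exists 1; rewrite ?mulr1.
have inv (x : R) : ~ M x -> invertible x.
  move=> Mx; have [y xy] := rinv _ Mx.
  (* If [y] were in [M], then so would be [y * x], and [1 - y * x] would have a right inverse [z].
     But [x * (1 - y * x) = 0], so multiplying by [z] gives [x = 0], an element of [M]. *)
  have My : ~ M y.
    move=> My; have M1yx : ~ M (1 - y * x).
      move=> M1yx; apply: M1; rewrite -(subrK (y * x) 1).
      by apply: right_ideal_addr => //; apply: MM.
    have [z yxz] := rinv _ M1yx.
    apply: Mx; rewrite -[x]mulr1 -yxz mulrA mulrBr mulr1 mulrA xy mul1r.
    by rewrite subrr mul0r; case: Mid.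
  have [x' yx'] := rinv _ My.
  have xx' : x = x' by rewrite -[x]mulr1 -yx' mulrA xy mul1r.
  by exists y; split=> //; rewrite xx'.
move=> x; have [Mx|/inv] := pselect (M x); last by left.
right; apply: inv => M1x; apply: M1.
by rewrite -(subrK x 1); apply: right_ideal_addr.
Qed.

(** Assuming the symmetric condition instead of locality lets the same statement serve [R] and
    [R^c]. *)
Lemma invertible_right_strongly_exchange (R : pzRingType) :
  (forall x : R, invertible x \/ invertible (1 - x)) ->
  right_strongly_exchange R.
Proof.
move=> Rinv.
have coprime_eqT (a b : R) : right_coprime a b ->
    principal_right_ideal a = setT \/ principal_right_ideal b = setT.
  move=> /right_coprimeP[r [s rs]].
  (* The complement [1 - a * r] is [b * s], so [a] or [b] gets a right inverse. *)
  have [[y [ary _]]|[y []]] := Rinv (a * r).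
    by left; apply/principal_right_ideal_eqT; exists (r * y); rewrite mulrA.
  rewrite -{1}rs addrAC subrr add0r => bsy _.
  by right; apply/principal_right_ideal_eqT; exists (s * y); rewrite mulrA.
move=> d I _ p [pdesc _].
have pleP i j : (i <= j)%O -> rcpair_le (repr (p j)) (repr (p i)).
  by rewrite -le_rcpE !reprK le_eqVlt => /predU1P[->|/pdesc].
have [pT|/existsNP[i iT]] :=
    pselect (forall i, principal_right_ideal (repr (p i)).1 = setT).
  exact: minimal_lower_bound10.
(* The first entry at [k] lies in the proper ideal of the first entry at [i], so the second entry at
   [k] generates [R], and hence so does the larger one at [j]. *)
apply: minimal_lower_bound01 => j; set k := Order.max i j.
have /pleP/asboolP[ki _] : (i <= k)%O by rewrite le_max lexx.
have /pleP/asboolP[_ kj] : (j <= k)%O by rewrite le_max lexx orbT.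
have [kT|kT] := coprime_eqT _ _ (rcpairP (repr (p k))).
  by case: iT; apply/seteqP; split=> //; rewrite -kT.
by apply/seteqP; split=> //; rewrite -kT.
Qed.

Theorem proposition3p7 (R : pzRingType) (hR : local_ring R) :
  right_strongly_exchange R /\ left_strongly_exchange R.
Proof.
have Rinv := local_ring_invertible hR.
split; apply: invertible_right_strongly_exchange => // x.
(* Reversing the product only swaps the two equations of an inverse. *)
by case: (Rinv x) => -[y [xy yx]]; [left|right]; exists y.
Qed.
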